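(* Let $(G,\tau,\oplus)$ be a strongly topological gyrogroup with a symmetric neighborhood base $\mathscr U$ at $0$, and let $H$ be a locally compact admissible subgyrogroup of $G$ generated from $\mathscr U$. If the quotient space $G/H$ has one of the following properties, then $G$ also has the same property: (1) locally compact; (2) locally countably compact; (3) locally pseudocompact; (4) locally $\sigma$-compact; (5) locally paracompact; (6) locally Lindelöf; (7) locally Čech-complete; (8) locally realcompact.
   Context: All topological spaces are assumed to be Hausdorff. A space $X$ has a property $\mathscr P$ locally if each point $x\in X$ has an open neighborhood $U(x)$ such that $\overline{U(x)}$ has $\mathscr P$. Realcompact means Hewitt–Nachbin complete. A gyrogroup is a nonempty set $G$ with a binary operation $\oplus$ such that: (G1) there is a unique element $0\in G$ with $0\oplus a=a=a\oplus 0$ for all $a\in G$; (G2) each $x\in G$ has a unique inverse $\ominus x$ with $\ominus x\oplus x=0=x\oplus(\ominus x)$; (G3) for all $x,y\in G$ there is an automorphism $\mathrm{gyr}[x,y]$ of $(G,\oplus)$ with $x\oplus(y\oplus z)=(x\oplus y)\oplus \mathrm{gyr}[x,y](z)$ for all $z\in G$; (G4) $\mathrm{gyr}[x\oplus y,y]=\mathrm{gyr}[x,y]$ for all $x,y\in G$. For subsets, $A\oplus B=\{a\oplus b:a\in A,b\in B\}$ and $\ominus A=\{\ominus a:a\in A\}$. A subgyrogroup of $G$ is a nonempty subset closed under $\ominus$ and $\oplus$. It is an $L$-subgyrogroup if moreover $\mathrm{gyr}[a,h](H)=H$ for all $a\in G$, $h\in H$. A topological gyrogroup $(G,\tau,\oplus)$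 is a gyrogroup with a topology $\tau$ such that $\oplus:G\times G\to G$ is jointly continuous and $x\mapsto\ominus x$ is continuous. It is a strongly topological gyrogroup with a symmetric neighborhood base $\mathscr U$ at $0$ if $\mathscr U$ is a neighborhood base of $0$ such that for every $U\in\mathscr U$, $\ominus U=U$ and $\mathrm{gyr}[x,y](U)=U$ for all $x,y\in G$. A subgyrogroup $H$ of a topological gyrogroup $G$ is admissible if there is a sequence $\{U_n:n\in\omega\}$ of open symmetric neighborhoods of $0$ with $U_{n+1}\oplus(U_{n+1}\oplus U_{n+1})\subset U_n$ for each $n\in\omega$ and $H=\bigcap_{n\in\omega}U_n$. If $G$ is a strongly topological gyrogroup with symmetric neighborhood base $\mathscr U$ at $0$ and the $U_n$ can be chosen with every $U_n\in\mathscr U$, then $H$ is said to be generated from $\mathscr U$. Such an $H$ is a closed $L$-subgyrogroup of $G$. $H$ is locally compact in the subspace topology. For an $L$-subgyrogroup $H$, $G/H=\{a\oplus H:a\in G\}$ is a partition of $G$; $\pi:G\to G/H$ is $\pi(a)=a\oplus H$, and $G/H$ carries the quotient topology ($O\subset G/H$ is open iff $\pi^{-1}(O)$ is open in $G$). *)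

(* Defs.v *)
Set Warnings "-notation-overridden,-notation-incompatible-prefix,-ambiguous-paths".
From HB Require Import structures.
From mathcomp Require Import all_boot all_order all_algebra generic_quotient.
From mathcomp Require Import all_classical all_reals all_analysis borel_hierarchy.

Set Implicit Arguments.
Unset Strict Implicit.
Unset Printing Implicit Defensive.

Import Order.TTheory GRing.Theory Num.Theory.
Import numFieldNormedType.Exports.

Local Open Scope classical_set_scope.
Local Open Scope ring_scope.
Local Open Scope quotient_scope.

(* The gyrator [gyr] is carried as data; it is determined by the other axioms,
   since gyr[x,y](z) = ⊖(x ⊕ y) ⊕ (x ⊕ (y ⊕ z)). *)
HB.mixin Record isGyrogroup G of Choice G := {
  gyrozero : G;
  gyroopp : G -> G;
  gyroadd : G -> G -> G;
  gyr : G -> G -> G -> G;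
  gyroadd0x : forall a, gyroadd gyrozero a = a;
  gyroaddx0 : forall a, gyroadd a gyrozero = a;
  gyrozero_unique : forall e,
    (forall a, gyroadd e a = a /\ gyroadd a e = a) -> e = gyrozero;
  gyroaddNx : forall x, gyroadd (gyroopp x) x = gyrozero;
  gyroaddxN : forall x, gyroadd x (gyroopp x) = gyrozero;
  gyroopp_unique : forall x y,
    gyroadd y x = gyrozero -> gyroadd x y = gyrozero -> y = gyroopp x;
  gyr_bij : forall x y, bijective (gyr x y);
  gyr_morph : forall x y a b,
    gyr x y (gyroadd a b) = gyroadd (gyr x y a) (gyr x y b);
  gyroaddA : forall x y z,
    gyroadd x (gyroadd y z) = gyroadd (gyroadd x y) (gyr x y z);
  gyr_loop : forall x y, gyr (gyroadd x y) y =1 gyr x y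
}.

#[short(type="gyrogroupType")]
HB.structure Definition Gyrogroup := {G of Choice G & isGyrogroup G}.

Arguments gyrozero {_}.

Declare Scope gyro_scope.
Delimit Scope gyro_scope with gyro.
Local Open Scope gyro_scope.
Notation "x ⊕ y" := (gyroadd x y) (at level 50, left associativity) : gyro_scope.
Notation "⊖ x" := (gyroopp x) (at level 35, right associativity) : gyro_scope.

HB.mixin Record Gyrogroup_isTopGyrogroup G of Topological G & Gyrogroup G := {
  gyroadd_continuous : continuous (fun p : G * G => p.1 ⊕ p.2);
  gyroopp_continuous : continuous (fun x : G => ⊖ x)
}.

#[short(type="topGyrogroupType")]
HB.structure Definition TopGyrogroup :=
  {G of Topological G & Gyrogroup G & Gyrogroup_isTopGyrogroup G}.

Section Subsets.
Context {G : gyrogroupType}.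
Implicit Types A B H : set G.

Definition gyroadd_set A B : set G := [set a ⊕ b | a in A & b in B].

Definition gyroopp_set A : set G := [set ⊖ a | a in A].

Definition subgyrogroup H :=
  [/\ H !=set0, (forall a, H a -> H (⊖ a)) &
      (forall a b, H a -> H b -> H (a ⊕ b))].

Definition left_gyrocoset (a : G) H : set G := [set a ⊕ h | h in H].

End Subsets.

Section Quotient.
Context {G : gyrogroupType} (H : set G).

Definition gyrocoset_rel (a b : G) : bool :=
  `[< left_gyrocoset a H = left_gyrocoset b H >].

Lemma gyrocoset_rel_refl : reflexive gyrocoset_rel.
Proof. by move=> a; apply/asboolP. Qed.

Lemma gyrocoset_rel_sym : symmetric gyrocoset_rel.
Proof. by move=> a b; apply/asboolP/asboolP => ->. Qed.

Lemma gyrocoset_rel_trans : transitive gyrocoset_rel.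
Proof. by move=> b a c /asboolP ab /asboolP bc; apply/asboolP; rewrite ab. Qed.

Canonical gyrocoset_equiv :=
  EquivRel gyrocoset_rel gyrocoset_rel_refl gyrocoset_rel_sym
    gyrocoset_rel_trans.

End Quotient.

(* The set {a ⊕ H : a in G}: two elements of G have the same class exactly when
   their left cosets are the same set, which makes sense for every H. *)
Definition gyroquotient (G : topGyrogroupType) (H : set G) : topologicalType :=
  quotient_topology {eq_quot (gyrocoset_equiv H)}.

Section StronglyTopological.
Context {G : topGyrogroupType}.
Implicit Types (B : set (set G)) (H : set G) (U : nat -> set G).

Definition symmetric_nbhs_base B :=
  [/\ (forall V, B V -> nbhs (gyrozero : G) V),
      (forall A, nbhs (gyrozero : G) A -> exists2 V, B V & V `<=` A) &
      (forall V, B V ->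
         gyroopp_set V = V /\ forall x y : G, [set gyr x y v | v in V] = V)].

Definition admissible_seq U H :=
  [/\ (forall n, open_nbhs (gyrozero : G) (U n)),
      (forall n, gyroopp_set (U n) = U n),
      (forall n, gyroadd_set (U n.+1) (gyroadd_set (U n.+1) (U n.+1)) `<=` U n) &
      H = \bigcap_n U n].

Definition admissible H := subgyrogroup H /\ exists U, admissible_seq U H.

Definition generated_from B H :=
  exists2 U, (forall n, B (U n)) & admissible_seq U H.

End StronglyTopological.

(* Spaces are assumed Hausdorff throughout, so no separation axiom is built into
   the covering properties below. *)

Definition locally_has (P : topologicalType -> Prop) (X : topologicalType) :=
  forall x : X, exists2 U : set X, open_nbhs x U & P (set_type (closure U)).

Definition open_cover (X : topologicalType) (C : set (set X)) :=
  C `<=` open /\ \bigcup_(A in C) A = setT.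

Definition compact_space (X : topologicalType) := compact [set: X].

Definition countably_compact_space (X : topologicalType) :=
  forall C : set (set X), countable C -> open_cover C ->
    exists D : set (set X), [/\ D `<=` C, finite_set D & open_cover D].

Definition lindelof_space (X : topologicalType) :=
  forall C : set (set X), open_cover C ->
    exists D : set (set X), [/\ D `<=` C, countable D & open_cover D].

Definition sigma_compact_space (X : topologicalType) :=
  exists2 K : nat -> set X, (forall n, compact (K n)) & \bigcup_n K n = setT.

Definition locally_finite (X : topologicalType) (D : set (set X)) :=
  forall x : X, exists2 U : set X, nbhs x U &
    finite_set [set A | D A /\ A `&` U !=set0].

Definition paracompact_space (X : topologicalType) :=
  forall C : set (set X), open_cover C ->
    exists D : set (set X), [/\ open_cover D,
      (forall A, D A -> exists2 B, C B & A `<=` B) & locally_finite D].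

Definition tychonoff_space (X : topologicalType) :=
  hausdorff_space X /\ completely_regular_space X.

Section RealValued.
Variables (R : realType) (X : topologicalType).

Definition pseudocompact_space :=
  forall f : X -> R, continuous f -> exists M : R, forall x, `|f x| <= M.

(* C(X, [0, 1]) *)
Definition unit_functions :=
  {f : X -> R | continuous f /\ forall x, 0 <= f x <= 1}.

Definition stone_cech_map (x : X) : prod_topology (fun _ : unit_functions => R) :=
  fun f => sval f x.

(* For X Tychonoff, the closure of X in the cube [0, 1]^C(X, [0, 1]), the cube
   being closed in the full power of R. *)
Definition stone_cech : topologicalType := set_type (closure (range stone_cech_map)).

Definition cech_complete_space :=
  tychonoff_space X /\
  Gdelta [set z : stone_cech | range stone_cech_map (set_val z)].

(* X is homeomorphic to a closed subspace of a power of the real line. *)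
Definition realcompact_space :=
  exists (I : Type) (e : X -> prod_topology (fun _ : I => R)),
    [/\ injective e,
        (forall A : set X, open A <-> exists2 O, open O & A = e @^-1` O) &
        closed (range e)].

End RealValued.

(* Main.v *)
Require Import Defs.
Set Warnings "-notation-overridden,-notation-incompatible-prefix,-ambiguous-paths".
Set Warnings "-redundant-canonical-projection".
From HB Require Import structures.
From mathcomp Require Import all_boot all_order all_algebra generic_quotient.
From mathcomp Require Import lra.
From mathcomp Require Import all_classical all_reals all_analysis.
From mathcomp Require Import borel_hierarchy.

(** Near each point the projection from G onto G/H is a perfect map, and each of
    the eight properties is carried from the target of such a map to its source.

    Call a and b close when ⊖ a ⊕ b lies in a small member V of the base.  As
    the members of the base are invariant under gyrations, this relation is
    unchanged by left translations ([left_near_gyroadd]) and it generates a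
    uniformity; so G is completely regular, hence Tychonoff.  For the same
    reason H, an intersection of members of the base, is invariant under
    gyrations, so the cosets a ⊕ H behave as in a group.  Right translations are
    homeomorphisms by the Bol identity ([gyroadd_bol]), so the projection is
    open.

    The heart is [coset_map_locally_perfect].  Suppose that points f stay close
    to x0 while their cosets accumulate at y ⊕ H.  Write f = y ⊕ (n ⊕ h) with n
    small and h in H.  Since ⊖ y ⊕ f = n ⊕ h is close to ⊖ y ⊕ x0, and a small
    left translation hardly moves that fixed point, h itself is close to it.
    Hence all these h are close to one of them, h0, and so stay in the compact
    set obtained by translating a compact neighborhood of 0 in H by h0.  An
    accumulation point k of the h gives an accumulation point y ⊕ k of the f.

    Given x in G and an open neighborhood W of its coset whose closure has the
    property, Urysohn functions provide a cozero neighborhood U of x whose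
    closure lies over W and in the region where the projection is perfect; the
    projection then restricts to a perfect map from the closure of U to the
    closure of W ([locally_has_lift]).  This map need not be onto.  Perfect maps
    pull back compactness and the properties defined by covers because a family
    covering a fiber has a finite part that covers the preimage of a
    neighborhood ([perfect_tube]).  For Čech-completeness and realcompactness, a
    perfect map also allows one to recognize, inside a cube or a power of the
    line, which limits of points of the source come from the source.
    Pseudocompactness is not pulled back by arbitrary perfect maps; here the
    projection is moreover open on U, which is dense in its closure, and taking
    suprema over fibers turns an unbounded function upstairs into an unbounded
    function downstairs ([perfect_pseudocompact]). *)

Set Implicit Arguments.
Unset Strict Implicit.
Unset Printing Implicit Defensive.

Import Order.TTheory GRing.Theory Num.Theory.
Import numFieldNormedType.Exports.

Local Open Scope classical_set_scope.
Local Open Scope ring_scope.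
Local Open Scope quotient_scope.
Local Open Scope gyro_scope.

(** * Perfect maps and covering properties *)

Section PerfectMaps.
Context {X Y : topologicalType}.
Implicit Types (f : X -> Y) (A : set X) (B : set (set X)).

(** The filter form of properness.  It is equivalent to asking for a continuous
    closed map with compact fibers, and passes to closed subspaces at once. *)
Definition perfect_map f := continuous f /\
  forall F : set_system X, ProperFilter F ->
    forall y, cluster (f @ F) y -> exists2 x, cluster F x & f x = y.

Definition fiber_core f A : set Y := [set y | forall x, f x = y -> A x].

Lemma cluster_cvg_continuous {Z : topologicalType} (g : X -> Z)
    (F : set_system X) x z : hausdorff_space Z -> {for x, continuous g} ->
  cluster F x -> g @ F --> z -> g x = z.
Proof.
move=> hZ gx Fx Fz; apply: hZ => A B gxA zB.
by have [w [Bw Aw]] := Fx _ _ (Fz _ zB) (gx _ gxA); exists (g w).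
Qed.

(** If every member of the directed family [B] missed some point of the preimage
    of every neighborhood of [y], these differences would generate a filter whose
    image clusters at [y], hence which clusters at a point of the fiber; but that
    point lies in an open member of [B]. *)
Lemma perfect_tube f B y : perfect_map f -> B !=set0 ->
    (forall A A', B A -> B A' -> exists2 A'', B A'' & A `|` A' `<=` A'') ->
    B `<=` open -> (forall x, f x = y -> exists2 A, B A & A x) ->
  exists2 A, B A & nbhs y (fiber_core f A).
Proof.
move=> [_ fperf] [A0 BA0] Bdir Bop Bcov; apply: contrapT => noA.
pose D := [set p : set Y * set X | nbhs y p.1 /\ B p.2].
pose F := filter_from D (fun p => f @^-1` p.1 `\` p.2).
have FF : Filter F.
  apply: filter_from_filter.
    by exists (setT, A0); split=> //; exact: filterT.
  move=> [N A] [N' A'] [/= yN BA] [/= yN' BA'].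
  have [A'' BA'' AA''] := Bdir _ _ BA BA'.
  exists (N `&` N', A''); first by split => //=; exact: filterI.
  move=> x [/= [Nx N'x] nA].
  by split; split => //= Ax; apply: nA; apply: AA''; [left|right].
have PF : ProperFilter F.
  apply: filter_from_proper => -[N A] [/= yN BA].
  apply: contrapT => /nonemptyPn/= e0; apply: noA; exists A => //.
  apply: filterS yN => z Nz x xz; apply: contrapT => nA.
  have : set0 x by rewrite -e0; split => //=; rewrite xz.
  by [].
have [|x Fx fxy] := fperf F PF y.
  move=> P N [[N' A] [/= yN' BA] sP] yN.
  have [x [[N'x Nx] nA]] : (f @^-1` (N' `&` N) `\` A) !=set0.
    apply: (@filter_ex _ F); exists (N' `&` N, A) => //; split => //=.
    exact: filterI.
  by exists (f x); split => //; apply: sP.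
have [A BA Ax] := Bcov x fxy.
have [w [[_ nAw] Aw]] : (f @^-1` setT `\` A) `&` A !=set0.
  apply: Fx; last by apply: open_nbhs_nbhs; split => //; exact: Bop.
  by exists (setT, A) => //; split => //; exact: filterT.
exact: nAw.
Qed.

Lemma perfect_core_nbhs f A y : perfect_map f -> open A ->
  (forall x, f x = y -> A x) -> nbhs y (fiber_core f A).
Proof.
move=> fperf oA Ay.
suff [_ ->] : exists2 A', [set A] A' & nbhs y (fiber_core f A') by [].
apply: perfect_tube => //.
- by exists A.
- by move=> _ _ -> ->; exists A => //; rewrite setUid.
- by move=> _ ->.
- by move=> x /Ay; exists A.
Qed.

(** The tube property for the finite unions of members of a cover. *)
Lemma perfect_cover f (C : set (set X)) : perfect_map f -> open_cover C ->
  forall y, exists2 D : set (set X), D `<=` C /\ finite_set D &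
    (fiber_core f (\bigcup_(A in D) A))° y.
Proof.
move=> fperf [Cop CT] y.
pose B := [set \bigcup_(A in D) A |
  D in [set D : set (set X) | D `<=` C /\ finite_set D]].
suff [A [D DC <-]] : exists2 A, B A & nbhs y (fiber_core f A) by exists D.
apply: perfect_tube => //.
- exists (\bigcup_(A in set0) A); exists set0 => //.
  by split; [exact: sub0set|exact: finite_set0].
- move=> _ _ [D [DC Dfin] <-] [D' [DC' Dfin'] <-].
  exists (\bigcup_(A in D `|` D') A); last by rewrite bigcup_setU.
  exists (D `|` D') => //; split; first by rewrite subUset.
  by rewrite finite_setU.
- by move=> _ [D [DC _] <-]; apply: bigcup_open => A /DC /Cop.
- move=> x _; have [A CA Ax] : (\bigcup_(A in C) A) x by rewrite CT.
  exists A => //; exists [set A]; last by rewrite bigcup_set1.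
  by split; [move=> _ ->|exact: finite_set1].
Qed.

Lemma perfect_compact_preimage f (K : set Y) : perfect_map f ->
  compact K -> compact (f @^-1` K).
Proof.
move=> [_ fperf] Kc F PF FK; have [y [Ky Fy]] := Kc (f @ F) _ FK.
by have [x Fx xy] := fperf F PF y Fy; exists x; split => //=; rewrite xy.
Qed.

Lemma perfect_compact f : perfect_map f ->
  compact_space Y -> compact_space X.
Proof.
by move=> fperf /(perfect_compact_preimage fperf); rewrite preimage_setT.
Qed.

Lemma perfect_sigma_compact f : perfect_map f ->
  sigma_compact_space Y -> sigma_compact_space X.
Proof.
move=> fperf [K Kc KT]; exists (fun n => f @^-1` K n).
  by move=> n; exact: perfect_compact_preimage.
by rewrite -preimage_bigcup KT preimage_setT.
Qed.

(** The cover of the target to which covering properties of the target are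
    applied: each member has its preimage covered by finitely many sets of [C]. *)
Definition core_family f (C : set (set X)) : set (set Y) :=
  [set (fiber_core f (\bigcup_(A in D) A))° |
    D in [set D : set (set X) | D `<=` C /\ finite_set D]].

Lemma core_family_cover f C : perfect_map f -> open_cover C ->
  open_cover (core_family f C).
Proof.
move=> fperf Ccov; split; first by move=> _ [D _ <-]; exact: open_interior.
apply/seteqP; split => // y _; have [D DC Dy] := perfect_cover fperf Ccov y.
by exists (fiber_core f (\bigcup_(A in D) A))° => //; exists D.
Qed.

Lemma core_family_pick f C : exists pick : set Y -> set (set X),
  forall W, core_family f C W -> [/\ pick W `<=` C, finite_set (pick W) &
    f @^-1` W `<=` \bigcup_(A in pick W) A].
Proof.
suff /choice[pick pickP] : forall W, exists D : set (set X),
    core_family f C W -> [/\ D `<=` C, finite_set D &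
    f @^-1` W `<=` \bigcup_(A in D) A] by exists pick.
move=> W; have [[D [DC Dfin] <-]|nW] := pselect (core_family f C W); last first.
  by exists set0 => /nW.
by exists D => _; split => // x /= /interior_subset; exact.
Qed.

Lemma core_family_subcover f (C : set (set X)) (E : set (set Y)) pick :
    open_cover C -> E `<=` core_family f C -> open_cover E ->
    (forall W, core_family f C W -> [/\ pick W `<=` C, finite_set (pick W) &
      f @^-1` W `<=` \bigcup_(A in pick W) A]) ->
  \bigcup_(W in E) pick W `<=` C /\ open_cover (\bigcup_(W in E) pick W).
Proof.
move=> [Cop _] EC [_ ET] pickP.
have sub : \bigcup_(W in E) pick W `<=` C.
  by move=> A [W /EC/pickP[+ _ _]]; exact.
split => //; split; first exact: subset_trans sub Cop.
apply/seteqP; split => // x _.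
have [W EW Wx] : (\bigcup_(W in E) W) (f x) by rewrite ET.
have [_ _ /(_ x Wx)[A WA Ax]] := pickP _ (EC _ EW).
by exists A => //; exists W.
Qed.

(** A countable cover has countably many finite subfamilies, so its core family
    is countable as well. *)
Lemma perfect_countably_compact f : perfect_map f ->
  countably_compact_space Y -> countably_compact_space X.
Proof.
move=> fperf Ycc C Cct Ccov; have [pick pickP] := core_family_pick f C.
have [|E [EC Efin Ecov]] :=
    Ycc (core_family f C) _ (core_family_cover fperf Ccov).
  apply: sub_countable (countable_finite_subset Cct).
  exact: card_image_le.
have [sub cov] := core_family_subcover Ccov EC Ecov pickP.
exists (\bigcup_(W in E) pick W); split => //.
by apply: bigcup_finite => // W /EC/pickP[].
Qed.

Lemma perfect_lindelof f : perfect_map f ->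
  lindelof_space Y -> lindelof_space X.
Proof.
move=> fperf Ylin C Ccov; have [pick pickP] := core_family_pick f C.
have [E [EC Ect Ecov]] := Ylin (core_family f C) (core_family_cover fperf Ccov).
have [sub cov] := core_family_subcover Ccov EC Ecov pickP.
exists (\bigcup_(W in E) pick W); split => //.
apply: bigcup_countable => // W /EC/pickP[_ + _].
exact: finite_set_countable.
Qed.

(** Each member [V] of a locally finite refinement of the core family is cut by
    the finitely many sets chosen for a member containing it; finiteness of these
    choices preserves local finiteness. *)
Lemma perfect_paracompact f : perfect_map f ->
  paracompact_space Y -> paracompact_space X.
Proof.
move=> fperf Ypar C Ccov; have [pick pickP] := core_family_pick f C.
have [E [[Eop ET] Eref Efin]] :=
  Ypar (core_family f C) (core_family_cover fperf Ccov).
have /choice[W WP] : forall V, exists W, E V -> core_family f C W /\ V `<=` W.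
  move=> V; have [/Eref[W ? ?]|nE] := pselect (E V); first by exists W.
  by exists set0 => /nE.
have [fcont _] := fperf; case: (Ccov) => Cop CT.
exists [set f @^-1` p.1 `&` p.2 | p in [set p | E p.1 /\ pick (W p.1) p.2]].
split; first split.
- move=> _ [[V A] [/= EV WA] <-]; apply: openI.
    by apply: open_comp => //; exact: Eop.
  by apply: Cop; have [CW _] := WP _ EV; have [+ _ _] := pickP _ CW; apply.
- apply/seteqP; split => // x _.
  have [V EV Vx] : (\bigcup_(V in E) V) (f x) by rewrite ET.
  have [CW VW] := WP _ EV; have [_ _ /(_ x (VW _ Vx))[A WA Ax]] := pickP _ CW.
  by exists (f @^-1` V `&` A) => //; exists (V, A).
- move=> _ [[V A] [/= EV WA] <-]; exists A; last exact: subIsetr.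
  by have [CW _] := WP _ EV; have [+ _ _] := pickP _ CW; apply.
- move=> x; have [N xN Nfin] := Efin (f x).
  exists (f @^-1` N); first exact: fcont.
  apply: (@sub_finite_set _ _ (\bigcup_(V in [set V | E V /\ V `&` N !=set0])
    [set f @^-1` V `&` A | A in pick (W V)])); last first.
    apply: bigcup_finite => // V [/WP[/pickP[_ + _] _] _]; exact: finite_image.
  move=> _ [[[V A] [/= EV WA] <-] [z [[Vz Az] Nz]]].
  by exists V; [split => //; exists (f z)|exists A].
Qed.

End PerfectMaps.

(** * Subspaces *)

Section Subspaces.
Context {X : topologicalType} (A : set X).

Lemma set_val_continuous : continuous (set_val : set_type A -> X).
Proof. exact: initial_continuous. Qed.

Lemma set_type_tychonoff (R : realType) :
  tychonoff_space X -> tychonoff_space (set_type A).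
Proof.
move=> [Xh Xcr]; split=> [p q pq|a B clB nBa].
  apply: val_inj; apply: Xh => U V pU qV.
  have [w [? ?]] := pq _ _ (set_val_continuous pU) (set_val_continuous qV).
  by exists (set_val w).
have [U oU UB] : open (~` B) by rewrite openC.
have Ua : U (set_val a) by rewrite -[U _]/((set_val @^-1` U) a) UB.
have clU : closed (~` U) by exact: open_closedC.
have nUa : ~ (~` U) (set_val a) by apply.
have /(@uniform_separatorP _ R)[g [gc g01 ga gU]] := Xcr _ _ clU nUa.
apply/(@uniform_separatorP _ R); exists (g \o set_val); split.
- move=> s.
  exact: (@continuous_comp _ _ _ set_val g s (@set_val_continuous s) (gc _)).
- by move=> _ [s _ <-]; apply: g01; exists (set_val s).
- by move=> _ [_ -> <-]; apply: ga; exists (set_val a).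
- move=> _ [b Bb <-]; apply: gU; exists (set_val b) => //= Ub.
  by have : (~` B) b by rewrite -UB.
Qed.

Lemma cluster_set_type (F : set_system (set_type A)) z :
    closed A -> ProperFilter F -> cluster (set_val @ F) z ->
  exists2 s, set_val s = z & cluster F s.
Proof.
move=> clA PF Fz.
have Az : A z.
  apply: clA => N zN; apply: Fz zN => /=.
  by apply: filterS filterT => s _; exact: set_valP.
exists (exist _ z (mem_set Az)) => // B N FB [_ [[M oM <-] /= Mz] MN].
have [|_ [[s Bs <-] Ms]] := Fz (set_val @` B) M _ (open_nbhs_nbhs (conj oM Mz)).
  by apply: (@filterS _ F _ _ _ _ FB) => s; exists s.
by exists s; split => //; exact: MN.
Qed.

End Subspaces.

(** * Embeddings into powers of the real line *)

Section Embeddings.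

Lemma prod_eval_continuous (I : Type) (K : I -> topologicalType) i :
  continuous (fun z : prod_topology K => z i).
Proof.
move=> z; have /cvg_sup/(_ i) zi : nbhs z --> (z : prod_topology K).
  exact: cvg_id.
move=> A Azi; apply: zi.
exact: (@initial_continuous _ _ (fun f : (forall i, K i) => f i)).
Qed.

Lemma continuous_prod (X : topologicalType) (I : Type)
    (K : I -> topologicalType) (g : X -> prod_topology K) :
  (forall i, continuous (fun x => g x i)) -> continuous g.
Proof.
move=> gi x; apply/cvg_sup => i.
exact: (@continuous_comp_initial _ _ _
  (fun f : (forall i, K i) => f i) g (gi i)).
Qed.

Lemma closure_range_filter (X : Type) (Z : topologicalType) (g : X -> Z) z :
  closure (range g) z -> exists2 F : set_system X, ProperFilter F & g @ F --> z.
Proof.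
move=> clz; exists (filter_from (nbhs z) (fun N => g @^-1` N)); last first.
  by move=> N zN; exists N.
apply: filter_from_proper.
  apply: filter_from_filter; first by exists setT; exact: filterT.
  by move=> N M zN zM; exists (N `&` M) => //; exact: filterI.
by move=> N /clz[_ [[x _ <-] Nx]]; exists x.
Qed.

Variable R : realType.

(** Urysohn functions small at the point, rather than large, so that sublevel sets
    serve as neighborhoods. *)
Lemma tychonoff_nbhs (X : topologicalType) (x : X) A :
  tychonoff_space X -> nbhs x A ->
  exists2 g : unit_functions R X, sval g x = 0 & [set y | sval g y < 1] `<=` A.
Proof.
move=> [_ Xcr] xA.
have cA : closed (~` A°) by apply: open_closedC; exact: open_interior.
have nAx : ~ (~` A°) x by apply; exact: xA.
have /(@uniform_separatorP _ R)[g [gc g01 gx gA]] := Xcr _ _ cA nAx.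
have gP : continuous g /\ forall x, 0 <= g x <= 1.
  split=> // y; have /g01 : range g (g y) by exists y.
  by rewrite /= in_itv.
exists (exist _ g gP) => /=; first by apply: gx; exists x.
move=> y /= gy; apply: interior_subset; apply: contrapT => nAy.
by have : g y = 1 by [apply: gA; exists y]; move=> gy1; rewrite gy1 ltxx in gy.
Qed.

(** A coordinate vanishing at [x] and equal to 1 off a neighborhood of [x] controls
    that neighborhood; hence the canonical map into the cube is an embedding. *)
Lemma stone_cech_map_cvg (X : topologicalType) (F : set_system X) (x : X) :
    Filter F -> tychonoff_space X ->
  @stone_cech_map R X @ F --> stone_cech_map x -> F --> x.
Proof.
move=> FF Xt Fx A xA; have [g gx gA] := tychonoff_nbhs Xt xA.
apply: filterS gA _.
have gF : (fun z : prod_topology (fun _ : unit_functions R X => R) => z g)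
    @ (@stone_cech_map R X @ F) --> sval g x.
  exact: continuous_cvg (@prod_eval_continuous _ _ g _) Fx.
rewrite gx in gF; have := gF _ (@lt_nbhsl R 0 1 ltr01).
exact.
Qed.

(** Composition with [f] induces a map between the Stone–Čech compactifications.
    Perfectness makes the preimage of the copy of [Y] exactly the copy of [X], and
    the preimage of a Gδ set is a Gδ set. *)
Lemma perfect_cech_complete (X Y : topologicalType) (f : X -> Y) :
    tychonoff_space X -> perfect_map f ->
  cech_complete_space R Y -> cech_complete_space R X.
Proof.
move=> Xt [fc fperf] [Yt [E oE EE]]; split => //.
pose pull (g : unit_functions R Y) : unit_functions R X :=
  exist _ (sval g \o f) (conj
    (fun x => continuous_comp (fc x) (proj1 (svalP g) (f x)))
    (fun x => proj2 (svalP g) (f x))).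
pose b (z : prod_topology (fun _ : unit_functions R X => R)) :
  prod_topology (fun _ : unit_functions R Y => R) := fun g => z (pull g).
have bc : continuous b.
  by apply: continuous_prod => g; exact: prod_eval_continuous.
have bmap x : b (stone_cech_map x) = stone_cech_map (f x) by [].
have bcl z : closure (range (@stone_cech_map R X)) z ->
    closure (range (@stone_cech_map R Y)) (b z).
  move=> clz N /bc/clz[_ [[x _ <-]] Nx].
  by exists (stone_cech_map (f x)); split => //; exists (f x).
pose bf (z : stone_cech R X) : stone_cech R Y :=
  exist _ (b (set_val z)) (mem_set (bcl _ (set_valP z))).
have bfc : continuous bf.
  apply: continuous_comp_initial => z.
  have vc : continuous (set_val : stone_cech R X -> _).
    exact: (@initial_continuous (stone_cech R X) _ set_val).
  exact: (@continuous_comp _ _ _ _ b z (vc z) (@bc _)).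
exists (fun i => bf @^-1` E i); first by move=> i; apply: open_comp.
rewrite -preimage_bigcap -EE; apply/seteqP; split => [z|z] /=.
  by move=> [x _ xz]; exists (f x) => //; rewrite -bmap xz.
move=> [y _ yz].
have [F FF Fz] := closure_range_filter (set_valP z).
have Fy : f @ F --> y.
  apply: stone_cech_map_cvg => //; rewrite yz.
  exact: (continuous_cvg _ (@bc _) Fz).
have [|x Fx xy] := fperf F FF y.
  by move=> A B FA /Fy FB; exact: filter_ex (filterI FA FB).
exists x => //; apply: functional_extensionality_dep => g.
apply: (@cluster_cvg_continuous _ _ (fun x => stone_cech_map x g) F x) => //.
  by have [gc _] := svalP g; exact: gc.
exact: (continuous_cvg _ (@prod_eval_continuous _ _ g _) Fz).
Qed.

(** The embedding of [X] pairs the functions into the unit interval, which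
    separate points from closed sets, with the closed embedding of [Y] after [f].
    A limit of its range has second component in the closed range of the
    embedding of [Y], and perfectness lifts that point to [X]. *)
Lemma perfect_realcompact (X Y : topologicalType) (f : X -> Y) :
    tychonoff_space X -> perfect_map f ->
  realcompact_space R Y -> realcompact_space R X.
Proof.
move=> Xt [fc fperf] [I [e [einj eopen eclosed]]].
pose J := (unit_functions R X + I)%type.
pose d (x : X) : prod_topology (fun _ : J => R) := fun j =>
  match j with inl g => sval g x | inr i => e (f x) i end.
have ec : continuous e.
  by apply/continuousP => A oA; apply/eopen; exists A.
have dc : continuous d.
  apply: continuous_prod => -[g|i] /=; first by have [] := svalP g.
  move=> x; apply: (@continuous_comp _ _ _ (e \o f) (fun z => z i)).
    exact: (@continuous_comp _ _ _ f e x (fc x) (@ec _)).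
  exact: prod_eval_continuous.
exists J, d; split.
- move=> x x' dxx'; apply: contrapT => /eqP nxx'.
  have [Xh _] := Xt.
  move: Xh => /hausdorff_accessible/(_ _ _ nxx').
  move=> [A [oA /set_mem Ax /set_mem nAx']].
  have [g gx gA] := tychonoff_nbhs Xt (open_nbhs_nbhs (conj oA Ax)).
  apply: nAx'; apply: gA; rewrite /= -[sval g x']/(d x' (inl g)) -dxx' /=.
  by rewrite gx ltr01.
- move=> A; split=> [oA|[V oV ->]]; last exact: open_comp.
  pose small := [set g : unit_functions R X | [set y | sval g y < 1] `<=` A].
  exists (\bigcup_(g in small)
    [set z : prod_topology (fun _ : J => R) | z (inl g) < 1]).
    apply: bigcup_open => g _.
    apply: (@open_comp _ _
      (fun z : prod_topology (fun _ : J => R) => z (inl g)) [set t | t < 1]).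
      by move=> ? _; exact: prod_eval_continuous.
    exact: open_lt.
  apply/seteqP; split => x /=.
    move=> Ax.
    have [g gx gA] := tychonoff_nbhs Xt (open_nbhs_nbhs (conj oA Ax)).
    by exists g => //=; rewrite gx ltr01.
  by move=> [g gA gx]; exact: gA.
move=> z clz; have [F FF Fz] := closure_range_filter clz.
pose r (w : prod_topology (fun _ : J => R)) : prod_topology (fun _ : I => R) :=
  fun i => w (inr i).
have rc : continuous r.
  by apply: continuous_prod => i; exact: prod_eval_continuous.
have [y _ yz] : range e (r z).
  apply: eclosed => N /rc/clz[_ [[x _ <-] Nx]].
  by exists (e (f x)); split => //; exists (f x).
have Fy : f @ F --> y.
  move=> A yA; rewrite nbhsE in yA; case: yA => B [/eopen[V oV BV] By] BA.
  apply: (@filterS _ (f @ F) _ _ _ BA); rewrite BV.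
  have : nbhs (r z) V.
    by apply: open_nbhs_nbhs; split => //; rewrite -yz; rewrite BV in By.
  by move=> /rc/Fz.
have [|x Fx xy] := fperf F FF y.
  by move=> A B FA /Fy FB; exact: filter_ex (filterI FA FB).
exists x => //; apply: functional_extensionality_dep => j.
apply: (@cluster_cvg_continuous _ _ (fun x => d x j) F x) => //.
- exact: (@continuous_comp _ _ _ d _ x (@dc x) (@prod_eval_continuous _ _ j _)).
- exact: (continuous_cvg _ (@prod_eval_continuous _ _ j _) Fz).
Qed.

Section WeightedSum.
Variables (c : nat -> R) (c0 : forall k, 0 <= c k).

Let term k (t : R) := c k * Num.max 0 (t - k%:R + 1).

Let partial n (t : R) := \sum_(0 <= k < n) term k t.

Let partialS n t : partial n.+1 t = partial n t + term n t.
Proof. by rewrite /partial big_nat_recr. Qed.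

Let term_ge0 k t : 0 <= term k t.
Proof. by rewrite mulr_ge0 // le_max lexx. Qed.

Let term_continuous k : continuous (term k).
Proof.
move=> t; apply: cvgM; first exact: cvg_cst.
apply: (@continuous_max _ R (cst 0) (fun u : R => u - k%:R + 1) t).
  exact: cvg_cst.
by apply: cvgD; [apply: cvgB; [exact: cvg_id|exact: cvg_cst]|exact: cvg_cst].
Qed.

Let partial_continuous n : continuous (partial n).
Proof.
elim: n => [|n IHn] t.
  rewrite (_ : partial 0 = cst 0); first exact: cvg_cst.
  by apply/funext => u; rewrite /partial big_nil.
rewrite (_ : partial n.+1 = partial n \+ term n); last first.
  by apply/funext => u; rewrite partialS.
by apply: cvgD; [exact: IHn|exact: term_continuous].
Qed.

Let partial_stable n m t : t <= n%:R - 1 -> t <= m%:R - 1 ->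
  partial n t = partial m t.
Proof.
wlog nm : n m / (n <= m)%N.
  by move=> W; have [/W//|/ltnW/W{}W ? ?] := leqP n m; apply/esym/W.
move=> tn _; rewrite -(subnK nm); elim: (m - n)%N => [//|i ->].
rewrite addSn partialS [X in _ = _ + X](_ : _ = 0) ?addr0 // /term.
have /max_idPl -> : t - (i + n)%:R + 1 <= 0; last by rewrite mulr0.
by have : (n%:R : R) <= (i + n)%:R by [rewrite ler_nat leq_addl]; lra.
Qed.

Let partial_ub k n t : (k < n)%N -> k%:R <= t -> c k <= partial n t.
Proof.
move=> kn kt; apply: (@le_trans _ _ (term k t)).
  by rewrite -[leLHS]mulr1 ler_wpM2l // le_max; apply/orP; right; lra.
rewrite /partial big_mkord (bigD1 (Ordinal kn)) //= lerDl.
by apply: sumr_ge0 => i _; exact: term_ge0.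
Qed.

(** A function of the form t ↦ Σ c k * max 0 (t - k + 1), a sum that is locally
    finite: the k-th term vanishes up to k - 1 and is at least [c k] from k on. *)
Lemma dominating_function : exists s : R -> R, [/\ continuous s,
  forall t, 0 <= s t & forall k t, k%:R <= t -> c k <= s t].
Proof.
pose n (t : R) := (Num.truncn t).+2.
have nP t : t < (n t)%:R - 1.
  by have := truncnS_gt t; rewrite /n -[_.+2%:R]natr1; lra.
exists (fun t => partial (n t) t); split => [t|t|k t kt].
- rewrite /continuous_at.
  apply: cvg_trans (@partial_continuous (n t) t).
  apply: near_eq_cvg; near=> u; apply: partial_stable; last exact: ltW.
  by apply: ltW; near: u; exact: lt_nbhsl.
- by apply: sumr_ge0 => i _; exact: term_ge0.
- apply: partial_ub => //.
  rewrite /n ltnS ltnW // -(ltr_nat R) (le_lt_trans kt) //.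
  exact: truncnS_gt.
Unshelve. all: by end_near. Qed.

End WeightedSum.

(** Let [g] be unbounded on [X].  Multiplying a fast-growing function of its
    absolute value by [theta] gives a continuous [h] that is still unbounded and
    vanishes outside the set where [theta] is positive, on which [f] is open.
    The supremum of [h] over the fibers of [f] is then continuous on [Y]: upper
    semicontinuous because [f] is perfect, lower semicontinuous because [f] is
    open where [h] is positive.  It is unbounded as well. *)
Lemma perfect_pseudocompact (X Y : topologicalType) (f : X -> Y)
    (theta : X -> R) :
    perfect_map f -> continuous theta -> (forall x, 0 <= theta x) ->
    dense [set x | 0 < theta x] ->
    (forall A, open A -> A `<=` [set x | 0 < theta x] -> open (f @` A)) ->
  pseudocompact_space R Y -> pseudocompact_space R X.
Proof.
move=> fperf thc th0 thdense fopen Ypc g gc; apply: contrapT => unb.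
have gnc : continuous (fun x => `|g x|).
  by move=> x; apply: cvg_norm; exact: gc.
have /choice[w wP] : forall k : nat, exists x, 0 < theta x /\ k%:R < `|g x|.
  move=> k; have [||x [/= kx thx]] := thdense [set x | k%:R < `|g x|].
  - apply: contrapT => /nonemptyPn e0; apply: unb; exists k%:R => x.
    by rewrite leNgt; apply/negP => kx; have : set0 x by rewrite -e0.
  - apply: (@open_comp _ _ (fun x => `|g x|) [set t | k%:R < t]).
      by move=> x _; exact: gnc.
    exact: open_gt.
  - by exists x.
(* The weights compensate for the smallness of theta at the chosen points, so that
   h below is at least k at the k-th of them. *)
have [|s [sc s0 sP]] := @dominating_function (fun k => k%:R / theta (w k)).
  by move=> k; rewrite divr_ge0.
pose h x := theta x * s `|g x|.
have hc : continuous h.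
  move=> x; apply: cvgM; first exact: thc.
  exact: (continuous_cvg _ (@sc _) (@gnc x)).
have h0 x : 0 <= h x by rewrite mulr_ge0.
have hw k : k%:R <= h (w k).
  have [thw /ltW kw] := wP k.
  by rewrite /h mulrC -ler_pdivrMr //; exact: sP.
have hpos c x : 0 <= c -> c < h x -> 0 < theta x.
  move=> c0 chx; rewrite lt_neqAle th0 andbT; apply/eqP => th0x.
  by move: chx; rewrite /h -th0x mul0r ltNge c0.
have oh c : open [set x | c < h x].
  apply: (@open_comp _ _ h [set t | c < t]); last exact: open_gt.
  by move=> x _; exact: hc.
have oh' c : open [set x | h x < c].
  apply: (@open_comp _ _ h [set t | t < c]); last exact: open_lt.
  by move=> x _; exact: hc.
(* The value 0 accounts for the empty fibers and does not change the supremum over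
   the others, as h is nonnegative. *)
pose V y := 0 |` [set h x | x in f @^-1` [set y]].
have Vub y : has_ubound (V y).
  have [_ [M _ <-] /nbhs_singleton My] :
      exists2 A, [set [set x | h x < M] | M in setT] A &
        nbhs y (fiber_core f A).
    apply: perfect_tube => //.
  - by exists [set x | h x < 0]; exists 0.
  - move=> _ _ [M _ <-] [M' _ <-]; exists [set x | h x < Num.max M M'].
      by exists (Num.max M M').
    by move=> x [] /= hx; rewrite lt_max hx // orbT.
  - by move=> _ [M _ <-]; exact: oh'.
  - move=> x _; exists [set u | h u < h x + 1]; first by exists (h x + 1).
    by rewrite /= ltrDl.
  exists (Num.max 0 M) => _ [->|[x xy <-]]; first by rewrite le_max lexx.
  by rewrite le_max (ltW (My x xy)) orbT.
have V0 y : V y !=set0 by exists 0; left.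
have Vsup y : has_sup (V y) by split.
pose k y := sup (V y).
have kh x : h x <= k (f x) by apply: sup_upper_bound => //; right; exists x.
have k0 y : 0 <= k y by apply: sup_upper_bound => //; left.
have kc : continuous k.
  move=> y; apply/cvgrPdist_lt => e e0.
  have up : \forall y' \near y, k y' < k y + e.
    have ylt x : f x = y -> h x < k y + e / 2.
      by move=> <-; rewrite (le_lt_trans (kh x)) // ltrDl divr_gt0.
    apply: filterS (perfect_core_nbhs fperf (@oh' _) ylt) => y' y'lt.
    have : k y' <= k y + e / 2; last by lra.
    apply: ge_sup => // _ [->|[x xy' <-]].
      by have := k0 y; lra.
    by apply: ltW; exact: y'lt.
  have low : \forall y' \near y, k y - e < k y'.
    have [kye|kye] := ltP (k y - e) 0.
      by near=> y'; rewrite (lt_le_trans kye).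
    have [_ [->|[x xy <-]] hx] := sup_adherent e0 (Vsup y).
      by move: hx; rewrite -/(k y) ltNge kye.
    have : nbhs y (f @` [set x | k y - e < h x]).
      apply: open_nbhs_nbhs; split; last by exists x.
      by apply: fopen => // x' /= /hpos; exact.
    apply: filterS => _ [x' hx' <-].
    exact: lt_le_trans hx' (kh x').
  near=> y'; rewrite ltr_distl; apply/andP; split.
    by rewrite ltrBlDr; near: y'.
  by rewrite -ltrBlDr; near: y'.
have [M kM] := Ypc k kc.
have := kM (f (w (Num.truncn M).+1)); rewrite ger0_norm // => kw.
have := le_trans (hw _) (le_trans (kh _) kw).
by rewrite leNgt truncnS_gt.
Unshelve. all: by end_near. Qed.

End Embeddings.

(** * Gyrogroup algebra *)

Section GyrogroupAlgebra.
Context {G : gyrogroupType}.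
Implicit Types a b c x y z h : G.

Lemma gyr_inj x y : injective (gyr x y).
Proof. exact: bij_inj (gyr_bij x y). Qed.

Lemma gyroadd_injl x : injective (gyroadd x).
Proof.
move=> a b /(congr1 (gyroadd (⊖ x))).
by rewrite !gyroaddA gyroaddNx !gyroadd0x => /gyr_inj.
Qed.

(** Used with the loop property to see that gyr[⊖ x, x] = gyr[0, x] is trivial,
    which gives left cancellation with ⊖ x. *)
Lemma gyr0x x : gyr gyrozero x =1 id.
Proof.
move=> z; apply: (@gyroadd_injl x).
by have := gyroaddA gyrozero x z; rewrite !gyroadd0x.
Qed.

Lemma gyroaddKl x : cancel (gyroadd x) (gyroadd (⊖ x)).
Proof.
move=> y; rewrite gyroaddA gyroaddNx gyroadd0x.
by rewrite -gyr_loop gyroaddNx gyr0x.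
Qed.

Lemma gyroaddNKl x : cancel (gyroadd (⊖ x)) (gyroadd x).
Proof. by move=> y; apply: (@gyroadd_injl (⊖ x)); rewrite gyroaddKl. Qed.

Lemma gyroopp0 : ⊖ gyrozero = gyrozero :> G.
Proof. by rewrite -[LHS]gyroadd0x gyroaddxN. Qed.

(** The left Bol identity.  In terms of left translations L, gyroassociativity
    says that gyr[x, y] is the inverse of L (x ⊕ y) composed with L x and L y.
    Substituting this on both sides of the loop property, with x = ⊖ b and
    x ⊕ y = a, gives L (a ⊕ (b ⊕ a)) = L a L b L a. *)
Lemma gyroadd_bol a b c : (a ⊕ (b ⊕ a)) ⊕ c = a ⊕ (b ⊕ (a ⊕ c)).
Proof.
set y := b ⊕ a; have xy : ⊖ b ⊕ y = a by rewrite /y gyroaddKl.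
have [g _ gyrK] := gyr_bij (⊖ b) y; set z := g c.
have zc : gyr (⊖ b) y z = c by rewrite /z gyrK.
have -> : a ⊕ y ⊕ c = a ⊕ (y ⊕ z).
  by rewrite gyroaddA -[in gyr a y]xy gyr_loop zc.
by rewrite -[in a ⊕ c]xy -[in _ ⊕ c]zc -gyroaddA gyroaddNKl.
Qed.

(** The solution x of x ⊕ h = y.  By the Bol identity, x = ⊖ h ⊕ (w ⊕ ⊖ h)
    satisfies x ⊕ h = ⊖ h ⊕ w, whence w = h ⊕ y.  The formula shows that the
    solution depends continuously on y. *)
Definition gyrosubr y h : G := ⊖ h ⊕ ((h ⊕ y) ⊕ ⊖ h).

Lemma gyrosubrK y h : gyrosubr y h ⊕ h = y.
Proof.
by rewrite /gyrosubr gyroadd_bol gyroaddNx gyroaddx0 gyroaddKl.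
Qed.

Lemma gyroaddK a h : gyrosubr (a ⊕ h) h = a.
Proof.
by rewrite /gyrosubr gyroadd_bol gyroaddxN gyroaddx0 gyroaddKl.
Qed.

Lemma gyrodiff_gyroadd x a b :
  ⊖ (x ⊕ a) ⊕ (x ⊕ b) = gyr x a (⊖ a ⊕ b).
Proof. by rewrite -{1}(gyroaddNKl a b) (gyroaddA x) gyroaddKl. Qed.

Definition gyr_invariant (A : set G) := forall x y v, A (gyr x y v) <-> A v.

Lemma image_gyr_invariant (A : set G) :
  (forall x y, [set gyr x y v | v in A] = A) -> gyr_invariant A.
Proof.
move=> AE x y v; split=> [|Av]; last by rewrite -(AE x y); exists v.
by rewrite -{1}(AE x y) => -[w Aw /gyr_inj <-].
Qed.

Lemma bigcap_gyr_invariant (U : nat -> set G) :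
  (forall n, gyr_invariant (U n)) -> gyr_invariant (\bigcap_n U n).
Proof.
by move=> Uinv x y v; split=> + n _ => /(_ n I) /(Uinv n x y).
Qed.

(** The entourage of the left uniformity attached to [V]. *)
Definition left_near (V : set G) a b := V (⊖ a ⊕ b).

Lemma left_near_gyroadd V x a b : gyr_invariant V ->
  left_near V (x ⊕ a) (x ⊕ b) <-> left_near V a b.
Proof. by move=> Vinv; rewrite /left_near gyrodiff_gyroadd; exact: Vinv. Qed.

Lemma left_near_sym V a b : gyr_invariant V -> gyroopp_set V = V ->
  left_near V a b -> left_near V b a.
Proof.
move=> Vinv Vopp Vab.
suff : left_near V (a ⊕ (⊖ a ⊕ b)) (a ⊕ gyrozero).
  by rewrite gyroaddNKl gyroaddx0.
apply/left_near_gyroadd => //; rewrite /left_near gyroaddx0.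
rewrite -Vopp; exists (⊖ a ⊕ b) => //.
Qed.

Lemma left_near_trans V W b a c : gyr_invariant V ->
  gyroadd_set V V `<=` W ->
  left_near V a b -> left_near V b c -> left_near W a c.
Proof.
move=> Vinv VW Vab Vbc; apply: VW.
have [g _ gyrK] := gyr_bij a (⊖ a ⊕ b).
exists (⊖ a ⊕ b) => //; exists (g (⊖ b ⊕ c)).
  by apply/(Vinv a (⊖ a ⊕ b)); rewrite gyrK.
apply: (@gyroadd_injl a); rewrite gyroaddA gyrK !gyroaddNKl //.
Qed.

End GyrogroupAlgebra.

(** * Strongly topological gyrogroups and their coset spaces *)

Section TopologicalGyrogroup.
Context {G : topGyrogroupType}.

Lemma continuous_gyroadd (X : topologicalType) (f g : X -> G) :
  continuous f -> continuous g -> continuous (fun x => f x ⊕ g x).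
Proof.
move=> fc gc x.
apply: (@cvg_comp _ _ _ (fun x => (f x, g x)) (fun p : G * G => p.1 ⊕ p.2)).
  exact: cvg_pair (fc x) (gc x).
exact: (@gyroadd_continuous G (f x, g x)).
Qed.

Lemma gyroadd_continuousl (a : G) : continuous (gyroadd a).
Proof. by apply: continuous_gyroadd => x; [exact: cvg_cst|exact: cvg_id]. Qed.

Lemma gyrosubr_continuous (h : G) : continuous (fun y : G => gyrosubr y h).
Proof.
apply: continuous_gyroadd => [x|]; first exact: cvg_cst.
apply: continuous_gyroadd => [|x]; last exact: cvg_cst.
exact: gyroadd_continuousl.
Qed.

Section SymmetricBase.
Variables (UU : set (set G)) (baseUU : symmetric_nbhs_base UU).

Let UU_nbhs V : UU V -> nbhs (gyrozero : G) V.
Proof. by case: baseUU => + _ _; exact. Qed.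

Let UU_sub A : nbhs (gyrozero : G) A -> exists2 V, UU V & V `<=` A.
Proof. by case: baseUU => _ + _; exact. Qed.

Let UU_opp V : UU V -> gyroopp_set V = V.
Proof. by case: baseUU => _ _ /[apply] -[]. Qed.

Lemma base_gyr_invariant V : UU V -> gyr_invariant V.
Proof. by case: baseUU => _ _ /[apply] -[_]; exact: image_gyr_invariant. Qed.

Lemma base_split V : UU V -> exists2 W, UU W & gyroadd_set W W `<=` V.
Proof.
move=> /UU_nbhs V0.
have : nbhs (gyrozero : G, gyrozero : G)
    ((fun p : G * G => p.1 ⊕ p.2) @^-1` V).
  by apply: gyroadd_continuous; rewrite /= gyroadd0x.
move=> [[A B] [/= A0 B0] AB].
have [W UW WAB] := UU_sub (filterI A0 B0).
exists W => // _ [a Wa [b Wb <-]]; apply: (AB (a, b)).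
by split; [exact: (WAB _ Wa).1|exact: (WAB _ Wb).2].
Qed.

Lemma left_near_nbhs V (x : G) : UU V -> nbhs x [set y | left_near V x y].
Proof.
move=> /UU_nbhs V0; apply: (@gyroadd_continuousl (⊖ x) x).
by rewrite gyroaddNx.
Qed.

Lemma left_near_basis (x : G) A : nbhs x A ->
  exists2 V, UU V & [set y | left_near V x y] `<=` A.
Proof.
move=> xA; have : nbhs (gyrozero : G) (gyroadd x @^-1` A).
  by apply: gyroadd_continuousl; rewrite gyroaddx0.
move=> /UU_sub[V UV VA]; exists V => // y /VA /=.
by rewrite gyroaddNKl.
Qed.

Definition left_entourage : set_system (G * G) :=
  filter_from UU (fun V => [set p | left_near V p.1 p.2]).

Let left_entourage_filter : Filter left_entourage.
Proof.
apply: filter_from_filter.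
  by have [V UV _] := UU_sub (@filterT _ _ (nbhs_filter _)); exists V.
move=> V W UV UW; have [Z UZ ZVW] := UU_sub (filterI (UU_nbhs UV) (UU_nbhs UW)).
by exists Z => // p /ZVW.
Qed.

Let left_entourage_refl A : left_entourage A -> diagonal `<=` A.
Proof.
move=> [V UV VA] [x y] /diagonalP ->; apply: VA.
by rewrite /= /left_near gyroaddNx; exact: nbhs_singleton (UU_nbhs UV).
Qed.

Let left_entourage_inv A : left_entourage A -> left_entourage A^-1%relation.
Proof.
move=> [V UV VA]; exists V => // -[x y] /= xy; apply: VA => /=.
by apply: left_near_sym => //; [exact: base_gyr_invariant|exact: UU_opp].
Qed.

Let left_entourage_split A : left_entourage A ->
  exists2 B, left_entourage B & (B \; B)%relation `<=` A.
Proof.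
move=> [V UV VA]; have [W UW WV] := base_split UV.
exists [set p | left_near W p.1 p.2]; first by exists W.
move=> [x z] [y /= xy yz]; apply: VA => /=.
exact: left_near_trans (base_gyr_invariant UW) WV xy yz.
Qed.

Let left_entourage_nbhs : nbhs = nbhs_ left_entourage :> (G -> set_system G).
Proof.
apply/funext => x; apply/seteqP; split => A.
  move=> /left_near_basis[V UV VA].
  exists [set p | left_near V p.1 p.2]; first by exists V.
  by move=> y /set_mem; exact: VA.
move=> [E [V UV VE] EA]; apply: filterS (left_near_nbhs x UV) => y xy.
by apply: EA; apply/mem_set/VE.
Qed.

(** A copy of the carrier of G, which keeps its topology and receives the left
    uniformity as a compatible uniform structure. *)
Definition left_uniform : Type := let _ := left_entourage_nbhs in G.

HB.instance Definition _ := Topological.copy left_uniform G.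
HB.instance Definition _ := @Nbhs_isUniform.Build left_uniform left_entourage
  left_entourage_filter left_entourage_refl left_entourage_inv
  left_entourage_split left_entourage_nbhs.

Lemma strongly_topological_completely_regular (R : realType) :
  completely_regular_space G.
Proof. exact: (@uniform_completely_regular R left_uniform). Qed.

Section QuotientMap.
Variables (H : set G) (subH : subgyrogroup H) (invH : gyr_invariant H).

Let H0 : H gyrozero.
Proof.
case: subH => -[a Ha] HN HD; rewrite -(gyroaddNx a).
by apply: HD => //; exact: HN.
Qed.

Definition coset_map (a : G) : gyroquotient H :=
  \pi_(quotient_topology {eq_quot (gyrocoset_equiv H)}) a.

Lemma coset_map_continuous : continuous coset_map.
Proof. exact: pi_continuous. Qed.

Lemma coset_map_surj q : exists a, coset_map a = q.
Proof. by exists (repr (q : quotient_topology _)); exact: reprK. Qed.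

Lemma coset_mapP a b : coset_map a = coset_map b <->
  exists2 h, H h & b = a ⊕ h.
Proof.
have -> : (coset_map a = coset_map b) <->
    left_gyrocoset a H = left_gyrocoset b H.
  have -> : (coset_map a = coset_map b) =
    (a = b %[mod {eq_quot (gyrocoset_equiv H)}]) by [].
  by split=> [/eqquotP/asboolP|ab]; last exact/eqquotP/asboolP.
have [_ HN HD] := subH.
split=> [ab|[h Hh ->]].
  have [h Hh ah] : left_gyrocoset a H b.
    by rewrite ab; exists gyrozero => //; rewrite gyroaddx0.
  by exists h.
apply/seteqP; split => _ [k Hk <-].
  exists (gyr a h (⊖ h ⊕ k)).
    by apply/invH; apply: HD => //; exact: HN.
  by rewrite -gyroaddA gyroaddNKl.
have [g _ gyrK] := gyr_bij a h.
exists (h ⊕ g k); first by apply: HD => //; apply/(invH a h); rewrite gyrK.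
by rewrite gyroaddA gyrK.
Qed.

(** The saturation of [A] is the union of its right translates by elements of H,
    which are open as preimages under the inverse translations. *)
Lemma coset_map_open A : open A -> open (coset_map @` A).
Proof.
move=> oA; suff : open (coset_map @^-1` (coset_map @` A)) by [].
rewrite (_ : _ @^-1` _ = \bigcup_(h in H) (fun y => gyrosubr y h) @^-1` A).
  apply: bigcup_open => h _; apply: open_comp => // x _.
  exact: gyrosubr_continuous.
apply/seteqP; split => [b [a Aa /coset_mapP[h Hh ->]]|b [h Hh /= Ab]].
  by exists h => //=; rewrite gyroaddK.
exists (gyrosubr b h) => //; apply/coset_mapP; exists h => //.
by rewrite gyrosubrK.
Qed.

Lemma locally_compact_subset : locally_has compact_space (set_type H) ->
  exists K N, [/\ compact K, K `<=` H, nbhs (gyrozero : G) N & N `&` H `<=` K].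
Proof.
pose zeroH : set_type H := exist _ gyrozero (mem_set H0).
move=> /(_ zeroH)[U [oU U0] cU].
have [N oN NU] := oU.
exists ((fun x : set_type (closure U) => set_val (set_val x)) @` setT), N; split.
- apply: continuous_compact => //; apply: continuous_subspaceT => x.
  exact: (@continuous_comp _ _ _ set_val set_val x
    (@set_val_continuous _ _ x) (@set_val_continuous _ _ _)).
- by move=> _ [x _ <-]; exact: set_valP.
- by apply: open_nbhs_nbhs; split => //; rewrite -NU in U0.
- move=> n [Nn Hn]; pose n' : set_type H := exist _ n (mem_set Hn).
  have Un : closure U n' by apply: subset_closure; rewrite -NU.
  by exists (exist _ n' (mem_set Un)).
Qed.

(** The convergence argument sketched at the top, for a filter in place of the
    points f.  Closeness at the scales [V], [V1], [V2] composes two steps at a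
    time: two instances of [V] place h near ⊖ y ⊕ x0, and two instances of [V1]
    place h near h0. *)
Lemma coset_map_locally_perfect : locally_has compact_space (set_type H) ->
  exists2 V, UU V & forall (x0 y : G) (F : set_system G), ProperFilter F ->
    F [set s | left_near V x0 s] -> cluster (coset_map @ F) (coset_map y) ->
    exists2 z, cluster F z & coset_map z = coset_map y.
Proof.
move=> /locally_compact_subset[K [N [Kc KH N0 NK]]].
have [_ HN HD] := subH.
have [V2 UV2 V2N] := UU_sub N0.
have [V1 UV1 V12] := base_split UV2.
have [V UV V01] := base_split UV1.
have [Vi V1i] := (base_gyr_invariant UV, base_gyr_invariant UV1).
exists V => // x0 y F PF FS Fy.
pose p0 := ⊖ y ⊕ x0.
pose M0 := [set n | left_near V p0 (⊖ n ⊕ p0)].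
have M00 : nbhs (gyrozero : G) M0.
  have cp0 : continuous (fun n : G => ⊖ n ⊕ p0).
    apply: continuous_gyroadd => x; [exact: gyroopp_continuous|exact: cvg_cst].
  by apply: cp0; rewrite gyroopp0 gyroadd0x; exact: left_near_nbhs.
(* Openness of the projection turns accumulation of cosets at y ⊕ H into
   points y ⊕ (n ⊕ h) of prescribed members of F, with n as small as wished. *)
have hit M Q : nbhs (gyrozero : G) M -> F Q -> exists n h,
    [/\ M n, H h, left_near V x0 (y ⊕ (n ⊕ h)) & Q (y ⊕ (n ⊕ h))].
  move=> M_0 FQ; pose A := [set s | M (⊖ y ⊕ s)].
  have yA : nbhs y A.
    by apply: (@gyroadd_continuousl (⊖ y) y); rewrite gyroaddNx.
  have [||_ [[f [Vf Qf] <-] [a /interior_subset Aa /coset_mapP[h Hh fE]]]] :=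
      Fy (coset_map @` ([set s | left_near V x0 s] `&` Q)) (coset_map @` A°).
  - by apply: (@filterS G F _ _ _ _ (filterI FS FQ)) => s; exists s.
  - apply: open_nbhs_nbhs; split; first exact/coset_map_open/open_interior.
    by exists y.
  have [g _ gyrK] := gyr_bij y (⊖ y ⊕ a).
  have fE' : f = y ⊕ ((⊖ y ⊕ a) ⊕ g h) by rewrite gyroaddA gyrK gyroaddNKl.
  exists (⊖ y ⊕ a), (g h); rewrite -fE'; split => //.
  by apply/(invH y (⊖ y ⊕ a)); rewrite gyrK.
have close n h : M0 n -> left_near V x0 (y ⊕ (n ⊕ h)) -> left_near V1 p0 h.
  move=> M0n nearf; apply: (left_near_trans Vi V01 M0n).
  rewrite -[X in left_near V _ X](gyroaddKl n).
  apply/(left_near_gyroadd _ _ _ Vi)/(left_near_gyroadd y _ _ Vi).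
  by rewrite gyroaddNKl.
have [n0 [h0 [M0n0 Hh0 nearf0 _]]] := hit _ _ M00 (@filterT _ _ _).
have K'c : compact (gyroadd h0 @` K).
  apply: continuous_compact => //; apply: continuous_subspaceT.
  exact: gyroadd_continuousl.
have K'P n h : M0 n -> H h -> left_near V x0 (y ⊕ (n ⊕ h)) ->
    (gyroadd h0 @` K) h.
  move=> M0n Hh nearf; exists (⊖ h0 ⊕ h); last by rewrite gyroaddNKl.
  apply: NK; split; last by apply: HD => //; exact: HN.
  apply: V2N; apply: (left_near_trans V1i V12 _ (close _ _ M0n nearf)).
  by apply: left_near_sym => //; [exact: UU_opp|exact: close nearf0].
(* The filter of the second components h, for n tending to 0 and the
   corresponding points running along F. *)
pose E (p : set G * set G) :=
  [set k | (gyroadd h0 @` K) k /\ exists2 n, p.1 n & p.2 (y ⊕ (n ⊕ k))].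
pose L := filter_from [set p | nbhs (gyrozero : G) p.1 /\ F p.2] E.
have PL : ProperFilter L.
  apply: filter_from_proper; first apply: filter_from_filter.
  - by exists (setT, setT); split; exact: filterT.
  - move=> [A B] [A' B'] [/= A0 FB] [/= A'0 FB'].
    exists (A `&` A', B `&` B'); first by split; exact: filterI.
    by move=> k [K'k [n [An A'n] [Bn B'n]]]; split; split => //; exists n.
  - move=> [A B] [/= A0 FB].
    have [n [h [[An M0n] Hh nearf Bf]]] := hit _ _ (filterI A0 M00) FB.
    by exists h; split; [exact: K'P nearf|exists n].
have [|k [K'k Lk]] := K'c L PL.
  by exists (setT, setT); [split; exact: filterT|move=> k []].
have Hk : H k by case: K'k => k' /KH Hk' <-; exact: HD.
exists (y ⊕ k); last by apply/esym/coset_mapP; exists k.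
move=> Q U FQ zU.
have cyk : continuous (fun p : G * G => y ⊕ (p.1 ⊕ p.2)).
  apply: continuous_gyroadd => [p|]; first exact: cvg_cst.
  exact: gyroadd_continuous.
have [|[A B] [/= A0 kB] AB] := cyk (gyrozero, k) U; first by rewrite /= gyroadd0x.
have [|k' [[_ [n An Qn]] Bk']] := Lk (E (A, Q)) B _ kB; first by exists (A, Q).
by exists (y ⊕ (n ⊕ k')); split => //; exact: (AB (n, k')).
Qed.

End QuotientMap.
End SymmetricBase.
End TopologicalGyrogroup.

(** * Localization *)

Section Localization.
Variables (R : realType) (G : topGyrogroupType) (hausG : hausdorff_space G).
Variables (UU : set (set G)) (baseUU : symmetric_nbhs_base UU).
Variables (H : set G) (subH : subgyrogroup H) (invH : gyr_invariant H).
Hypothesis lcH : locally_has compact_space (set_type H).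

(** The interface between the geometry of G/H and the preservation lemmas.  Apart
    from perfectness, [f] is known to be open on the open sets contained in a
    dense cozero set, the one of [theta]. *)
Lemma locally_has_lift (P : topologicalType -> Prop) :
    (forall (X Y : topologicalType) (f : X -> Y) (theta : X -> R),
      tychonoff_space X -> perfect_map f ->
      continuous theta -> (forall x, 0 <= theta x) ->
      dense [set x | 0 < theta x] ->
      (forall A, open A -> A `<=` [set x | 0 < theta x] -> open (f @` A)) ->
      P Y -> P X) ->
  locally_has P (gyroquotient H) -> locally_has P G.
Proof.
move=> PP locP x.
have [W [oW Wx] PW] := locP (coset_map H x).
have [V UV Vperf] := coset_map_locally_perfect baseUU subH invH lcH.
have Gt : tychonoff_space G.
  by split; last exact: (strongly_topological_completely_regular baseUU R).
pose S := [set s | left_near V x s] `&` coset_map H @^-1` W.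
have xS : nbhs x S.
  apply: filterI; first exact: (left_near_nbhs baseUU).
  by apply: coset_map_continuous; exact: open_nbhs_nbhs.
have [g gx gS] := tychonoff_nbhs R Gt xS.
have [gc g01] := svalP g.
(* The level 1/2 keeps the closure of U inside the set where g < 1, and makes
   U the cozero set of 1/2 - g on that closure. *)
pose U := [set y | sval g y < 1 / 2].
have oU : open U.
  apply: (@open_comp _ _ (sval g) [set t | t < 1 / 2]); last exact: open_lt.
  by move=> y _; exact: gc.
have clU y : closure U y -> sval g y <= 1 / 2.
  have : closed [set y | sval g y <= 1 / 2].
    apply: (@preimage_closed _ _ (sval g) [set t | t <= 1 / 2]).
      2: exact: closed_le.
    by move=> ? _; exact: gc.
  move=> cl yU; apply: cl; apply: closureS yU => z; exact: ltW.
have clUS : closure U `<=` S by move=> y /clU gy; apply: gS => /=; lra.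
exists U; first by split => //; rewrite /U /= gx; lra.
have clUW (s : set_type (closure U)) : closure W (coset_map H (set_val s)).
  by apply: subset_closure; have [] := clUS _ (set_valP s).
pose f (s : set_type (closure U)) : set_type (closure W) :=
  exist _ (coset_map H (set_val s)) (mem_set (clUW s)).
have vc : continuous (set_val : set_type (closure U) -> G).
  exact: set_val_continuous.
apply: (PP _ _ f (fun s => 1 / 2 - sval g (set_val s))) PW.
- exact: set_type_tychonoff.
- split.
    apply: continuous_comp_initial => s.
    exact: (@continuous_comp _ _ _ set_val (coset_map H) s (vc s)
      (@coset_map_continuous _ H _)).
  move=> F PF q Fq; have [y yq] := coset_map_surj (set_val q).
  have [| |z Fz zy] := Vperf x y (set_val @ F) _.
  - apply: (@filterS _ F _ _ _ _ filterT) => s _.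
    by have [] := clUS _ (set_valP s).
  - rewrite yq => B N FB qN.
    have [|t [Bt Nt]] :=
        Fq (set_val @^-1` B) (set_val @^-1` N) _ (set_val_continuous qN).
      by [].
    by exists (set_val t).
  have [s sz Fs] := cluster_set_type (@closed_closure _ U) PF Fz.
  by exists s => //; apply: val_inj; rewrite -[RHS]/(set_val q) -yq -zy -sz.
- have subc : continuous (fun t : R => 1 / 2 - t).
    by move=> t; apply: cvgB; [exact: cvg_cst|exact: cvg_id].
  move=> s; apply: (@continuous_comp _ _ _ (sval g \o set_val)) (subc _).
  exact: (@continuous_comp _ _ _ set_val (sval g) s (vc s) (gc _)).
- by move=> s; rewrite subr_ge0; apply: clU; exact: set_valP.
- move=> B [s Bs] [N oN NB].
  have [|u [Uu Nu]] := set_valP s N.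
    by apply: open_nbhs_nbhs; split => //; rewrite -NB in Bs.
  have clu := subset_closure Uu.
  exists (exist _ u (mem_set clu)); split; first by rewrite -NB.
  by rewrite /= subr_gt0.
- move=> B [N oN NB] Bth.
  exists (coset_map H @` (N `&` U)).
    by apply: coset_map_open => //; exact: openI.
  apply/seteqP; split => [q [u [Nu Uu] uq]|_ [s Bs <-]].
    have clu := subset_closure Uu.
    exists (exist _ u (mem_set clu)); first by rewrite -NB.
    exact: val_inj.
  exists (set_val s) => //; split; first by rewrite -NB in Bs.
  by have := Bth _ Bs; rewrite /= subr_gt0.
Qed.

End Localization.

Theorem corollary3p7 (R : realType) (G : topGyrogroupType)
    (hausG : hausdorff_space G)
    (UU : set (set G)) (baseUU : symmetric_nbhs_base UU)
    (H : set G) (admH : admissible H) (genH : generated_from UU H)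
    (lcH : locally_has compact_space (set_type H)) :
  (locally_has compact_space (gyroquotient H) -> locally_has compact_space G) /\
  (locally_has countably_compact_space (gyroquotient H) ->
     locally_has countably_compact_space G) /\
  (locally_has (pseudocompact_space R) (gyroquotient H) ->
     locally_has (pseudocompact_space R) G) /\
  (locally_has sigma_compact_space (gyroquotient H) ->
     locally_has sigma_compact_space G) /\
  (locally_has paracompact_space (gyroquotient H) ->
     locally_has paracompact_space G) /\
  (locally_has lindelof_space (gyroquotient H) ->
     locally_has lindelof_space G) /\
  (locally_has (cech_complete_space R) (gyroquotient H) ->
     locally_has (cech_complete_space R) G) /\
  (locally_has (realcompact_space R) (gyroquotient H) ->
     locally_has (realcompact_space R) G).
Proof.
have [subH _] := admH.
have invH : gyr_invariant H.
  have [U UUU [_ _ _ ->]] := genH.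
  by apply: bigcap_gyr_invariant => n; exact: base_gyr_invariant baseUU _ (UUU n).
have lift P := @locally_has_lift R G hausG UU baseUU H subH invH lcH P.
do ![split]; apply: lift => X Y f theta Xt fperf thc th0 thdense fopen.
- exact: perfect_compact fperf.
- exact: perfect_countably_compact fperf.
- exact: perfect_pseudocompact fperf thc th0 thdense fopen.
- exact: perfect_sigma_compact fperf.
- exact: perfect_paracompact fperf.
- exact: perfect_lindelof fperf.
- exact: perfect_cech_complete Xt fperf.
- exact: perfect_realcompact Xt fperf.
Qed.
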